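(* Let $G=(G'_\ell,A'_\ell,B'_\ell)\circ(G'_{\ell-1},A'_{\ell-1},B'_{\ell-1})\circ\cdots\circ(G'_1,A'_1,B'_1)\circ G'_0$ be the compact canonical decomposition of a graph $G$. Then every automorphism $\pi$ of $G$ satisfies $\pi(V(G'_i))=V(G'_i)$ for every $i=0,\dots,\ell$, and the map $\pi\mapsto(\pi|_{V(G'_\ell)},\dots,\pi|_{V(G'_0)})$ is a group isomorphism $$\mathrm{Aut}(G)\cong\mathrm{Aut}(G'_\ell)\times\mathrm{Aut}(G'_{\ell-1})\times\cdots\times\mathrm{Aut}(G'_1)\times\mathrm{Aut}(G'_0);$$ in particular, any choice of automorphisms $\pi_i\in\mathrm{Aut}(G'_i)$ combines into an automorphism of $G$.
   Context: All graphs are finite and simple; $\mathrm{Aut}(G)$ is the group of automorphisms (adjacency-preserving bijections $V(G)\to V(G)$). A graph is split if its vertex set can be partitioned into $A$ (inducing a complete graph) and $B$ (inducing an independent set), either possibly empty; $(A,B)$ is a $KS$-partition. For split $(G,A,B)$ with $V(G)\neq\emptyset$ and a graph $H$, $V(H)\neq\emptyset$, on disjoint vertices, $(G,A,B)\circ H$ is the graph on $V(G)\cup V(H)$ with edge set $E(G)\cup E(H)\cup\{uv:u\in A,v\in V(H)\}$; this is associative and iterated compositions are read right-nested. A graph is indecomposable if it is not isomorphic to any such composition. Canonical decomposition (Tyshkevich): every graph is $G=(G_k,A_k,B_k)\circ\cdots\circ(G_1,A_1,B_1)\circ G_0$ with every $G_i$ indecomposable, unique up to componentwise isomorphism. A single-vertex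 component $(G_i,A_i,B_i)$, $i\ge1$, has type $K_1$ if $A_i=V(G_i)$ and type $S_1$ if $B_i=V(G_i)$; if $G_0$ and $G_1$ are both single-vertex graphs, $G_0$ is assigned the type of $G_1$. The compact canonical decomposition is obtained from the canonical decomposition by replacing each maximal run of consecutive single-vertex components of the same type by a single component: a run of $m$ components of type $K_1$ is replaced by the complete graph $K_m$ with $KS$-partition $(V(K_m),\emptyset)$, and a run of $m$ components of type $S_1$ by the edgeless graph on $m$ vertices with $KS$-partition $(\emptyset,\text{all vertices})$ (if the run contains $G_0$, the replacement becomes the new last component $G'_0$). It is unique up to isomorphism, and each component is an indecomposable graph with at least two vertices, a complete graph, or an edgeless graph. *)

(* Defs.v *)
From mathcomp Require Import all_boot all_fingroup.
Set Implicit Arguments. Unset Strict Implicit. Unset Printing Implicit Defensive.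

(* A finite simple graph G is a symmetric irreflexive relation e on a finType T;
   V(G) = T.  All decompositions are represented *internally*: components are
   induced subgraphs G[V_i] on the blocks V_i of a partition of T. *)

Section Graphs.
Variable T : finType.
Variable e : rel T.

Definition clique (A : {set T}) :=
  [forall x in A, forall y in A, (x != y) ==> e x y].
Definition indep (B : {set T}) :=
  [forall x in B, forall y in B, ~~ e x y].

Definition ks_part (V A B : {set T}) :=
  [&& A :&: B == set0, A :|: B == V, clique A & indep B].

(* G[V] is isomorphic to a composition (G[X],A,B) o G[Y]:
   V = X disjoint-union Y, both nonempty, (A,B) a KS-partition of G[X],
   and for u in X, v in Y: uv is an edge iff u \in A. *)
Definition decomposable_on (V : {set T}) :=
  exists X A B Y : {set T},
    [&& X :&: Y == set0, X :|: Y == V, X != set0, Y != set0, ks_part X A B &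
        [forall u in X, forall v in Y, e u v == (u \in A)]].

Definition indecomposable_on (V : {set T}) := ~ decomposable_on V.

(* A decomposition G = (G_k,A_k,B_k) o ... o (G_1,A_1,B_1) o G_0 is given by
   comps = [:: (A_1,B_1); ...; (A_k,B_k)] (V(G_i) = A_i :|: B_i) and V0 = V(G_0). *)
Definition parts (comps : seq ({set T} * {set T})) (V0 : {set T}) : seq {set T} :=
  V0 :: [seq p.1 :|: p.2 | p <- comps].

Definition is_decomp (comps : seq ({set T} * {set T})) (V0 : {set T}) :=
  [/\ all (fun V => V != set0) (parts comps V0),
      all (fun p => ks_part (p.1 :|: p.2) p.1 p.2) comps,
      (forall x : T, count (fun V : {set T} => x \in V) (parts comps V0) = 1%N) &
      (forall i j : nat, (j < i < size (parts comps V0))%N ->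
         forall u v : T, u \in nth set0 (parts comps V0) i ->
                         v \in nth set0 (parts comps V0) j ->
         e u v = (u \in (nth (set0, set0) comps i.-1).1))].

Definition canonical_decomp (comps : seq ({set T} * {set T})) (V0 : {set T}) :=
  is_decomp comps V0 /\ forall V, V \in parts comps V0 -> indecomposable_on V.

(* Types of single-vertex components: Some true = K_1, Some false = S_1,
   None = untyped (at least two vertices, or G_0 not followed by a single vertex). *)
Definition comp_type (p : {set T} * {set T}) : option bool :=
  if #|p.1 :|: p.2| == 1%N then Some (p.1 == p.1 :|: p.2) else None.

Definition item := (option bool * ({set T} * {set T}))%type.

(* merge maximal runs of consecutive single-vertex components of the same type;
   a K-run becomes (union, set0) = (V(K_m), emptyset), an S-run (set0, union) *)
Fixpoint compress (s : seq item) : seq item :=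
  match s with
  | [::] => [::]
  | x :: s' =>
    match compress s' with
    | [::] => [:: x]
    | y :: ys =>
      if (x.1 != None) && (x.1 == y.1)
      then (x.1, (x.2.1 :|: y.2.1, x.2.2 :|: y.2.2)) :: ys
      else x :: y :: ys
    end
  end.

Definition type0 (comps : seq ({set T} * {set T})) (V0 : {set T}) : option bool :=
  if #|V0| == 1%N then
    (if comps is p :: _ then comp_type p else None)
  else None.

(* items for G_0, G_1, ..., G_k (G_0 stored as (V0, set0); only its vertex set matters) *)
Definition items (comps : seq ({set T} * {set T})) (V0 : {set T}) : seq item :=
  (type0 comps V0, (V0, set0)) :: [seq (comp_type p, p) | p <- comps].

Definition compact_parts (comps : seq ({set T} * {set T})) (V0 : {set T}) : seq {set T} :=
  [seq x.2.1 :|: x.2.2 | x <- compress (items comps V0)].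

Definition graph_aut : {set {perm T}} :=
  [set p : {perm T} | [forall x, forall y, e (p x) (p y) == e x y]].

(* Aut(G[V]) realised as permutations of T supported on V *)
Definition aut_on (V : {set T}) : {set {perm T}} :=
  [set p : {perm T} | perm_on V p &&
     [forall x in V, forall y in V, e (p x) (p y) == e x y]].

End Graphs.

(* Main.v *)
(** Two vertices lying in different components [V_m], [V_j] (m < j) with the
    same degree are twins: the neighbourhood of the upper one contains, or is
    contained in, that of the lower one, up to the two vertices themselves.
    Twinship and indecomposability force every component between [V_m] and
    [V_j] to be a single vertex of one common type, so that both vertices lie
    in the same compact component.  As automorphisms preserve degrees, they
    preserve the compact components.  Conversely, in an indecomposable split
    graph with at least two vertices the KS-partition is preserved by every
    automorphism, so that automorphisms of the components can be glued. *)

Require Import Defs.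
From mathcomp Require Import all_boot all_fingroup.
Set Implicit Arguments. Unset Strict Implicit. Unset Printing Implicit Defensive.

(** The default fails [P], so both positions lie inside [s], and two distinct ones would be counted
    twice. *)
Lemma count_le1_nth_inj (T : eqType) (d : T) (P : pred T) (s : seq T) i j :
    ~~ P d -> count P s <= 1 ->
  P (nth d s i) -> P (nth d s j) -> i = j.
Proof.
move=> Pd; elim: s i j => [|x s IHs] i j /=.
  by rewrite nth_nil (negPf Pd).
have noP k : count P s = 0 -> ~~ P (nth d s k).
  move=> /eqP; rewrite eqn0Ngt -has_count => /hasPn nP.
  by have [lt_ks|le_sk] := ltnP k (size s); [exact/nP/mem_nth | rewrite nth_default].
case: (boolP (P x)) => Px; rewrite ?add1n ?add0n ?ltnS ?leqn0 => cnt.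
  have nP k := noP k (eqP cnt).
  by case: i j => [|i] [|j] //=; rewrite (negPf (nP _)) // => _; rewrite (negPf (nP _)).
by case: i j => [|i] [|j] /=; rewrite ?(negPf Px) // => Pi Pj; rewrite (IHs i j).
Qed.

(** * Runs of equal types and the blocks formed by [compress] *)

Section Runs.

Definition same_run (a b : option bool) := (a != None) && (a == b).

(** Counting the run boundaries before position [i] gives the position in [compress] of the block
    that absorbs item [i]. An untyped item is a run by itself, and the default [None] puts a
    boundary at every step past the end. *)
Definition run_index (t : seq (option bool)) (i : nat) : nat :=
  \sum_(j < i) ~~ same_run (nth None t j) (nth None t j.+1).

Lemma run_index0 t : run_index t 0 = 0.
Proof. exact: big_ord0. Qed.

Lemma run_index_cons a t i :
  run_index (a :: t) i.+1 = ~~ same_run a (nth None t 0) + run_index t i.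
Proof. by rewrite /run_index big_ord_recl. Qed.

Lemma run_indexS t i :
  run_index t i.+1 = run_index t i + ~~ same_run (nth None t i) (nth None t i.+1).
Proof. exact: big_ord_recr. Qed.

Lemma run_index_mono t : {homo run_index t : i j / i <= j}.
Proof. by apply: homo_leq => // [? ? ?|i]; [exact: leq_trans | rewrite run_indexS leq_addr]. Qed.

(** No boundary occurs between [i] and [j], so each type there equals the next one and is not
    [None]. *)
Lemma run_index_type t i j : i < j -> run_index t i = run_index t j ->
  exists b, forall l, i <= l <= j -> nth None t l = Some b.
Proof.
elim: j => // j IHj; rewrite ltnS => le_ij eq_ij.
have := run_index_mono t le_ij; rewrite eq_ij run_indexS.
rewrite -[X in _ <= X]addn0 leq_add2l leqn0 eqb0 negbK => /andP[tj_typed /eqP tjS].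
move: tj_typed; case tj: (nth None t j) => [b|] // _.
case: ltngtP le_ij => // [lt_ij|eq_i] _; last first.
  exists b => l; rewrite eq_i => /andP[le_jl]; rewrite leq_eqVlt => /orP[/eqP->|].
    by rewrite -tjS.
  by rewrite ltnS => le_lj; have -> : l = j by apply/eqP; rewrite eqn_leq le_lj.
have [|c tc] := IHj lt_ij.
  apply/eqP; rewrite eqn_leq (run_index_mono _ (ltnW lt_ij)) eq_ij.
  exact: run_index_mono.
exists c => l /andP[le_il]; rewrite leq_eqVlt => /orP[/eqP->|].
  by rewrite -tjS tc // leqnn ltnW.
by rewrite ltnS => le_lj; rewrite tc // le_il.
Qed.

Lemma run_index_eq t b i j : i <= j ->
    (forall l, i <= l <= j -> nth None t l = Some b) ->
  run_index t i = run_index t j.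
Proof.
elim: j => [|j IHj]; first by case: i.
rewrite leq_eqVlt => /orP[/eqP-> //|]; rewrite ltnS => le_ij tb.
rewrite run_indexS !tb ?leqnSn ?le_ij ?leqnn ?(leq_trans le_ij) //.
rewrite /same_run eqxx addn0; apply: IHj => // l /andP[le_il le_lj].
by rewrite tb // le_il ltnW.
Qed.

Variable T : finType.
Implicit Type s : seq (item T).

Let vset (x : item T) := x.2.1 :|: x.2.2.

(** Merging keeps the type of the front item, so the test in [compress] against the compressed tail
    amounts to comparing two adjacent types of the original list. *)
Lemma compress_cons x s : exists ys y, compress (x :: s) = y :: ys /\ y.1 = x.1.
Proof.
rewrite /=; case: (compress s) => [|z zs]; first by exists [::], x.
by case: ifP => _; eexists; eexists.
Qed.

(** A new front item either joins block 0 and leaves all indices as they are, or opens a block and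
    shifts them by one; [run_index_cons] follows the same two cases. *)
Lemma mem_nth_compress s k (x : T) :
  x \in nth set0 (map vset (compress s)) k <->
  exists2 i, run_index (map fst s) i = k & x \in nth set0 (map vset s) i.
Proof.
elim: s k => [|y s IHs] k.
  by rewrite nth_nil inE; split=> // -[i _]; rewrite nth_nil inE.
case: s IHs => [|z s] IHs.
  split; first by case: k => [xy|k] /=; [exists 0; rewrite ?run_index0 | rewrite nth_nil inE].
  by case=> -[|i]; [rewrite run_index0 => <- | rewrite /= nth_nil inE].
have [ws [w [zE wz]]] := compress_cons z s.
have cE : compress [:: y, z & s] = if same_run y.1 w.1
    then (y.1, (y.2.1 :|: w.2.1, y.2.2 :|: w.2.2)) :: ws else [:: y, w & ws].
  by rewrite -[LHS]/(if compress (z :: s) is w0 :: ws0 then if same_run y.1 w0.1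
    then (y.1, (y.2.1 :|: w0.2.1, y.2.2 :|: w0.2.2)) :: ws0 else [:: y, w0 & ws0] else _) zE.
have zs0 : nth None (map fst (z :: s)) 0 = z.1 by [].
(* From here on the tail matters only through the type of its head, so [z :: s] is generalised. *)
rewrite cE {cE}; rewrite zE in IHs; move: (z :: s) IHs zs0 => {zE}s IHs s0.
case: ifP => same.
  have rE i : run_index [seq i.1 | i <- y :: s] i.+1 = run_index [seq i.1 | i <- s] i.
    by rewrite run_index_cons s0 -wz same.
  have vE : vset (y.1, (y.2.1 :|: w.2.1, y.2.2 :|: w.2.2)) = vset y :|: vset w.
    by rewrite /vset /= setUACA.
  case: k => [|k]; rewrite [map vset _]/= vE [nth _ _ _]/=.
    rewrite inE; split=> [/orP[xy|xw]|].
    - by exists 0; rewrite ?run_index0.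
    - by have [i ri xi] := (IHs 0).1 xw; exists i.+1; rewrite ?rE.
    case=> -[|i]; first by rewrite /= => _ ->.
    by rewrite rE /= => ri xi; apply/orP; right; apply: (IHs 0).2; exists i.
  split=> [xk|].
    by have [i ri xi] := (IHs k.+1).1 xk; exists i.+1; rewrite ?rE.
  case=> -[|i]; rewrite ?run_index0 // rE /= => ri xi.
  by apply: (IHs k.+1).2; exists i.
have rE i : run_index [seq i.1 | i <- y :: s] i.+1 = (run_index [seq i.1 | i <- s] i).+1.
  by rewrite run_index_cons s0 -wz same.
case: k => [|k].
  split=> [xy|]; first by exists 0; rewrite ?run_index0.
  by case=> -[|i] //; rewrite rE.
split=> [xk|].
  by have [i ri xi] := (IHs k).1 xk; exists i.+1; rewrite ?rE ?ri.
case=> -[|i]; rewrite ?run_index0 // rE => -[ri] xi.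
by apply: (IHs k).2; exists i.
Qed.

(** A merge replaces two sets by their union, and a point of the union was counted at least once
    before. *)
Lemma count_compress s (x : T) :
  count (fun V : {set T} => x \in V) (map vset (compress s)) <=
  count (fun V : {set T} => x \in V) (map vset s).
Proof.
elim: s => //= y s; case: (compress s) => [|w ws] /= IHs.
  by rewrite leq_add2l.
case: ifP => _ /=; last by rewrite leq_add2l.
rewrite /vset /= setUACA inE; apply: leq_trans (leq_add (leqnn _) IHs).
by rewrite addnA leq_add2r; case: (x \in y.2.1 :|: _); rewrite // ?leq_addr.
Qed.

End Runs.

(** * Permutations acting block by block, as an internal direct product *)

Section Blocks.

Variables (T : finType) (e : rel T).
Implicit Types (V : {set T}) (cs : seq {set T}) (p : {perm T}).

(** A pointwise description of the product of the groups [aut_on e V] over disjoint blocks; edges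
    between different blocks are left unconstrained. *)
Definition block_auts cs : {set {perm T}} :=
  [set p | perm_on (\bigcup_(V <- cs) V) p &&
     all (fun V => (p \in 'N(V | 'P)%g) &&
            [forall x in V, forall y in V, e (p x) (p y) == e x y]) cs].

Lemma block_autsP cs p :
  reflect [/\ perm_on (\bigcup_(V <- cs) V) p,
              forall V, V \in cs -> forall x, (p x \in V) = (x \in V) &
              forall V, V \in cs -> {in V &, forall x y, e (p x) (p y) = e x y}]
          (p \in block_auts cs).
Proof.
rewrite inE; apply: (iffP andP) => [[pon /allP pV]|[pon pV eV]]; split=> //.
- by move=> V /pV/andP[/astabsP pN _] x; have := pN x.
- move=> V /pV/andP[_ /forall_inP eV] x y xV yV.
  by have /forall_inP/(_ y yV)/eqP := eV x xV.
apply/allP => V Vcs; apply/andP; split; first by apply/astabsP => x; apply: pV.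
by apply/forall_inP => x xV; apply/forall_inP => y yV; apply/eqP/(eV V).
Qed.

Lemma group_set_block_auts cs : group_set (block_auts cs).
Proof.
apply/group_setP; split.
  by apply/block_autsP; split=> [|V _ x|V _ x y _ _]; rewrite ?perm_on1 ?perm1.
move=> p q /block_autsP[pon pV ep] /block_autsP[qon qV eq].
apply/block_autsP; split=> [|V Vcs x|V Vcs x y xV yV]; first exact: perm_onM.
  by rewrite permM qV ?pV.
by rewrite !permM (eq V) ?(pV V) ?(ep V).
Qed.
Canonical block_auts_group cs := Group (group_set_block_auts cs).

Lemma aut_onE V : aut_on e V = block_auts [:: V].
Proof.
apply/setP => p; rewrite !inE big_seq1 /= andbT andbA; congr (_ && _).
case pon: (perm_on V p) => //=; symmetry; apply/astabsP => x.
exact: (perm_closed x pon).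
Qed.

(** The counting condition says that the blocks are disjoint. Disjoint supports give commutation and
    trivial intersection, and a blockwise permutation splits off its restriction to the first
    block. *)
Lemma block_auts_dprod cs :
    (forall x, count (fun V : {set T} => x \in V) cs <= 1) ->
  (\big[dprod/1]_(V <- cs) aut_on e V)%g = block_auts cs.
Proof.
elim: cs => [|V cs IHcs] cnt.
  rewrite big_nil; apply/setP => p; rewrite inE; symmetry.
  apply/idP/eqP => [|->]; last exact: (group1 (block_auts_group [::])).
  case/block_autsP; rewrite big_nil => pon _ _.
  by apply/permP => x; rewrite perm1 (out_perm pon) ?inE.
have disj W x : W \in cs -> x \in V -> x \notin W.
  move=> Wcs xV; apply/negP => xW; move: (cnt x); rewrite /= xV add1n ltnS leqn0.
  by rewrite eqn0Ngt -has_count => /hasP; case; exists W.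
have disjU x : x \in V -> x \notin \bigcup_(W <- cs) W.
  rewrite bigcup_seq => xV; apply/bigcupP => -[W Wcs xW].
  by case/negP: (disj W x Wcs xV).
rewrite big_cons {}IHcs => [|x]; last by apply: leq_trans (cnt x); apply: leq_addl.
rewrite aut_onE dprodE /=; first 1 last.
- apply/centsP => q /block_autsP[qon _ _] p /block_autsP[]; rewrite big_seq1 => pon _ _.
  apply/permP => x; rewrite !permM.
  case: (boolP (x \in V)) => xV.
    by rewrite (out_perm qon) ?disjU // (out_perm qon) // disjU // (perm_closed x pon).
  rewrite (out_perm pon xV); case: (boolP (x \in \bigcup_(W <- cs) W)) => xU; last first.
    by rewrite (out_perm qon xU) (out_perm pon).
  rewrite (out_perm pon) //; apply/negP => /disjU.
  by rewrite (perm_closed x qon) xU.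
- apply/trivgP/subsetP => p /setIP[/block_autsP[]]; rewrite big_seq1 => pon _ _.
  case/block_autsP=> qon _ _; rewrite inE; apply/eqP/permP => x; rewrite perm1.
  by case: (boolP (x \in V)) => [/disjU|] ?; [apply: out_perm qon _ | apply: out_perm pon _].
apply/setP => p; apply/mulsgP/idP => [[q r] |].
  move=> /block_autsP[]; rewrite big_seq1 => qon _ eq /block_autsP[ron rW er] ->.
  have rV x : x \in V -> r x = x by move/disjU; apply: out_perm ron.
  have qW W x : W \in cs -> x \in W -> q x = x.
    by move=> Wcs xW; apply: (out_perm qon); apply: contraL xW; apply: disj.
  have rVE x : (r x \in V) = (x \in V).
    apply/idP/idP => [rxV|xV]; last by rewrite rV.
    by have /perm_inj <- : r (r x) = r x by apply: rV.
  have qWE W x : W \in cs -> (q x \in W) = (x \in W).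
    move=> Wcs; apply/idP/idP => [qxW|xW]; last by rewrite (qW W).
    by have /perm_inj <- : q (q x) = q x by apply: (qW W).
  apply/block_autsP; split.
  - rewrite big_cons; apply: perm_onM; apply: subset_trans (_ : _ \subset _); first exact: qon.
    + exact: subsetUl.
    + exact: ron.
    + exact: subsetUr.
  - move=> W; rewrite inE => /predU1P[->|Wcs] x; rewrite permM.
      by rewrite rVE (perm_closed x qon).
    by rewrite rW // qWE.
  move=> W; rewrite inE => /predU1P[->|Wcs] x y xW yW; rewrite !permM.
    by rewrite !rV ?(perm_closed _ qon) // (eq V) ?inE.
  by rewrite !(qW W) // (er W).
case/block_autsP=> pon pW ep.
have pN : p \in 'N(V | 'P)%g by apply/astabsP => x; apply: pW; rewrite inE eqxx.
(* The factor on [V] is the restriction [q] of [p]; the remaining factor [q^-1 * p] is the identity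
   on [V] and agrees with [p] on the other blocks. *)
have qon := restr_perm_on V p; set q := restr_perm V p in qon *.
have qE x : x \in V -> q x = p x by move=> xV; apply: restr_permE.
exists q (q^-1 * p)%g; last by rewrite mulKVg.
  apply/block_autsP; rewrite big_seq1; split=> // W; rewrite inE => /eqP->.
    by move=> x; apply: perm_closed.
  by move=> x y xV yV; rewrite !qE // (ep V) // inE eqxx.
have qV W x : W \in cs -> x \in W -> (q^-1)%g x = x.
  by move=> Wcs xW; apply: (out_perm (perm_onV qon)); apply: contraL xW; apply: disj.
have qWE W x : W \in cs -> ((q^-1)%g x \in W) = (x \in W).
  move=> Wcs; apply/idP/idP => [qxW|xW]; last by rewrite (qV W).
  by have /perm_inj <- : (q^-1 (q^-1 x) = q^-1 x)%g by apply: (qV W).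
apply/block_autsP; split.
- apply/subsetP => x; rewrite inE permM; apply: contraR => xU.
  case: (boolP (x \in V)) => xV.
    have qxV : (q^-1)%g x \in V by rewrite (perm_closed x (perm_onV qon)).
    by rewrite -qE // permKV.
  rewrite (out_perm (perm_onV qon)) // (out_perm pon) // big_cons inE.
  by rewrite (negPf xV).
- by move=> W Wcs x; rewrite permM pW ?qWE // inE Wcs orbT.
by move=> W Wcs x y xW yW; rewrite !permM !(qV W) // (ep W) // inE Wcs orbT.
Qed.

End Blocks.

(** * Rigidity of indecomposable graphs *)

Section Indecomposable.

Variables (T : finType) (e : rel T).
Hypotheses (e_sym : symmetric e) (e_irr : irreflexive e).
Implicit Types (V A B : {set T}) (p : {perm T}).

Lemma ks_partP V A B :
  reflect [/\ V = A :|: B, (forall x, x \in A -> x \notin B),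
              {in A &, forall x y, x != y -> e x y} &
              {in B &, forall x y, ~~ e x y}]
          (ks_part e V A B).
Proof.
apply: (iffP and4P) => [[/eqP dAB /eqP <- cA iB]|[-> dAB cA iB]]; split=> //.
- move=> x xA; apply/negP => xB; have := in_set0 x.
  by rewrite -dAB inE xA xB.
- by move=> x y xA yA; have /forall_inP/(_ x xA)/forall_inP/(_ y yA)/implyP := cA.
- by move=> x y xB yB; have /forall_inP/(_ x xB)/forall_inP/(_ y yB) := iB.
- apply/eqP/setP => x; rewrite !inE; apply/negP => /andP[/dAB].
  by move/negP.
- by apply/forall_inP => x xA; apply/forall_inP => y yA; apply/implyP/cA.
by apply/forall_inP => x xB; apply/forall_inP => y yB; apply: iB.
Qed.

(** Otherwise [y] would split off as an upper single-vertex component, of type [K_1] or [S_1]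
    according to [b]. *)
Lemma indecomposable_uniform V y b : indecomposable_on e V -> y \in V ->
  (forall z, z \in V -> z != y -> e y z = b) -> V = [set y].
Proof.
move=> indV yV yb; have [Vy0|Vy0] := eqVneq (V :\ y) set0.
  by rewrite -(setD1K yV) Vy0 setU0.
case: indV; exists [set y], (if b then [set y] else set0),
  (if b then set0 else [set y]), (V :\ y); apply/and5P; split=> //.
- by apply/eqP/setP => z; rewrite !inE; case: eqP.
- by rewrite setD1K.
- by apply/set0Pn; exists y; rewrite inE.
apply/andP; split.
  apply/ks_partP; case: (b); split; rewrite ?set0U ?setU0 //.
  - by move=> x _; rewrite inE.
  - by move=> x z /set1P-> /set1P->; rewrite eqxx.
  - by move=> x z; rewrite !inE.
  - by move=> x; rewrite in_set0.
  - by move=> x z; rewrite !inE.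
  by move=> x z /set1P-> /set1P->; rewrite e_irr.
apply/forall_inP => u /set1P->; apply/forall_inP => v /setD1P[vy vV].
by rewrite yb //; case: (b); rewrite inE ?eqxx.
Qed.

(** Otherwise [u] would split off as the lower component: the rest of [V], with the partition
    induced by [A] and [B], sees [u] exactly from [A]. *)
Lemma indecomposable_swing V A B u : indecomposable_on e V -> ks_part e V A B ->
  u \in V -> (forall z, z \in V -> z != u -> e u z = (z \in A)) -> V = [set u].
Proof.
move=> indV /ks_partP[VE dAB cA iB] uV uA; have [Vu0|Vu0] := eqVneq (V :\ u) set0.
  by rewrite -(setD1K uV) Vu0 setU0.
case: indV; exists (V :\ u), (A :\ u), (B :\ u), [set u].
apply/and5P; split=> //.
- by apply/eqP/setP => z; rewrite !inE; case: eqP; rewrite ?andbF.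
- by rewrite setUC setD1K.
- by apply/set0Pn; exists u; rewrite inE.
apply/andP; split.
  apply/ks_partP; split.
  - by rewrite VE setDUl.
  - by move=> x; rewrite !inE => /andP[_ /dAB/negPf->]; rewrite andbF.
  - by move=> x y /setD1P[_ xA] /setD1P[_ yA]; apply: cA.
  by move=> x y /setD1P[_ xA] /setD1P[_ yA]; apply: iB.
apply/forall_inP => z /setD1P[zu zV]; apply/forall_inP => v /set1P->.
by rewrite e_sym uA // !inE zu.
Qed.

(** If [x] is in [A] and [p x] is in [B], then [N (p x)] lies in [A] and [N x] contains [A :\ x].
    The two neighbourhoods have equal size, so one of these inclusions is an equality; then [p x] or
    [x] is a swing vertex and [V] a singleton, against [x != p x]. *)
Lemma indecomposable_aut_ks V A B p : indecomposable_on e V -> ks_part e V A B ->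
    (forall x, (p x \in V) = (x \in V)) ->
    {in V &, forall x y, e (p x) (p y) = e x y} ->
  forall x, x \in V -> (p x \in A) = (x \in A).
Proof.
move=> indV ksV pV ep; have /ks_partP[VE dAB cA iB] := ksV.
have AV x : x \in A -> x \in V by rewrite VE inE => ->.
have BV x : x \in V -> x \notin A -> x \in B.
  by rewrite VE inE => /orP[->|].
pose N x := [set z in V | e x z].
have cardN x : x \in V -> #|N (p x)| = #|N x|.
  move=> xV; rewrite -(card_imset (N x) (@perm_inj _ p)); apply: eq_card => z.
  apply/idP/imsetP => [|[w + ->]]; rewrite !inE => /andP[zV exz].
    exists ((p^-1)%g z); last by rewrite permKV.
    have wV : (p^-1)%g z \in V by rewrite -pV permKV.
    by rewrite inE wV -ep // permKV.
  by rewrite pV zV ep.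
have pA x : x \in A -> p x \in A.
  move=> xA; have xV := AV x xA; apply: contraT => pxA.
  have pxV : p x \in V by rewrite pV.
  have px_x : x != p x by apply: contraNneq pxA => <-.
  have sNpx : N (p x) \subset A.
    apply/subsetP => z; rewrite inE => /andP[zV]; apply: contraLR => zA.
    by apply: iB; apply: BV.
  have sNx : A :\ x \subset N x.
    by apply/subsetP => z /setD1P[zx zA]; rewrite inE AV // cA // eq_sym.
  have [NpxA|NpxA] := eqVneq (N (p x)) A.
    have VE1 : V = [set p x].
      by apply: (indecomposable_swing indV ksV) => // z zV _; rewrite -NpxA inE zV.
    by move: px_x; rewrite -in_set1 -VE1 xV.
  (* Now [N (p x)] is a proper subset of [A], so [N x] has at most [#|A| - 1] elements. *)
  have NxA : A :\ x = N x.
    apply/eqP; rewrite eqEcard sNx -cardN // -ltnS.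
    have := cardsD1 x A; rewrite xA add1n => <-.
    by apply: proper_card; rewrite properEneq NpxA.
  have VE1 : V = [set x].
    apply: (indecomposable_swing indV ksV) => // z zV zx.
    by have := in_setD1 z A x; rewrite NxA inE zV zx.
  by move: pxV; rewrite VE1 inE eq_sym (negPf px_x).
have pAE : p @: A = A.
  apply/eqP; rewrite eqEcard (card_imset _ (@perm_inj _ p)) leqnn andbT.
  by apply/subsetP => _ /imsetP[x xA ->]; apply: pA.
by move=> x _; rewrite -{1}pAE (mem_imset _ _ (@perm_inj _ p)).
Qed.

End Indecomposable.

(** * Components of the canonical decomposition and their types *)

Section CompactDecomposition.

Variables (T : finType) (e : rel T).
Hypotheses (e_sym : symmetric e) (e_irr : irreflexive e).
Variables (comps : seq ({set T} * {set T})) (V0 : {set T}).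
Hypothesis canonical : canonical_decomp e comps V0.

Notation part := (nth set0 (parts comps V0)).
(** The list [comps] starts at [G_1] while [parts] starts at [G_0], hence the shift; the value is
    meaningful only for positive [i]. *)
Notation clique_part i := (nth (set0, set0) comps i.-1).1.
Notation types := (map fst (items comps V0)).

Lemma part_bound i (x : T) : x \in part i -> i < size (parts comps V0).
Proof. by case: ltnP => // le_si; rewrite nth_default ?inE. Qed.

Lemma part_exists (x : T) : exists i, x \in part i.
Proof.
have [[_ _ cnt _] _] := canonical.
exists (find (fun V : {set T} => x \in V) (parts comps V0)).
by apply: (nth_find set0 (a := fun V : {set T} => x \in V)); rewrite has_count cnt.
Qed.

Lemma part_inj (x : T) i j : x \in part i -> x \in part j -> i = j.
Proof.
have [[_ _ cnt _] _] := canonical => xi xj.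
by apply: (@count_le1_nth_inj _ set0 (fun V : {set T} => x \in V) (parts comps V0));
  rewrite ?inE ?cnt.
Qed.

Lemma edge_part i j (u v : T) : j < i -> u \in part i -> v \in part j ->
  e u v = (u \in clique_part i).
Proof.
have [[_ _ _ edge] _] := canonical => lt_ji ui vj.
by apply: (edge i j); rewrite // lt_ji (part_bound ui).
Qed.

Lemma indecomposable_part i (x : T) : x \in part i -> indecomposable_on e (part i).
Proof. by have [_ ind] := canonical => xi; apply/ind/mem_nth/(part_bound xi). Qed.

Lemma part_pos i (x : T) : x \in part i.+1 ->
  let p := nth (set0, set0) comps i in
  part i.+1 = p.1 :|: p.2 /\ ks_part e (part i.+1) p.1 p.2.
Proof.
have [[_ ks _ _] _] := canonical => xi; have lt_i : i < size comps.
  by have := part_bound xi; rewrite /= size_map.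
have E : part i.+1 = (nth (set0, set0) comps i).1 :|: (nth (set0, set0) comps i).2.
  by rewrite /= (nth_map (set0, set0)).
by split=> //; rewrite E; apply: (allP ks); apply: mem_nth.
Qed.

Lemma nth_types i (x : T) : x \in part i.+1 ->
  nth None types i.+1 = comp_type (nth (set0, set0) comps i).
Proof.
move=> xi; have lt_i : i < size comps by have := part_bound xi; rewrite /= size_map.
by rewrite /= -map_comp (nth_map (set0, set0)).
Qed.

Lemma type_of_singleton i (x : T) : part i.+1 = [set x] ->
  nth None types i.+1 = Some (x \in clique_part i.+1).
Proof.
move=> Ei; have xi : x \in part i.+1 by rewrite Ei inE.
have [E _] := part_pos xi; rewrite (nth_types xi) /comp_type -E Ei cards1 eqxx /=.
congr Some; have : (nth (set0, set0) comps i).1 \subset [set x].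
  by rewrite -Ei E subsetUl.
rewrite subset1 => /orP[/eqP->|/eqP->]; first by rewrite eqxx inE eqxx.
by rewrite inE; apply/negbTE/negP => /eqP/setP/(_ x); rewrite !inE eqxx.
Qed.

Lemma type_clique_part i (x : T) b : x \in part i.+1 ->
  nth None types i.+1 = Some b -> (x \in clique_part i.+1) = b.
Proof.
move=> xi; have [E _] := part_pos xi.
have [|nE] := boolP (#|part i.+1| == 1).
  case/cards1P=> y Ey; move: (xi); rewrite Ey inE => /eqP xy.
  by rewrite (@type_of_singleton _ x) ?xy // => -[].
by rewrite (nth_types xi) /comp_type -E (negPf nE).
Qed.

(** * Equal degrees, twins and runs *)

Lemma edge_above (u y z : T) j m l : m < j -> j < l ->
  u \in part j -> y \in part m -> z \in part l -> e z y = e z u.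
Proof.
move=> lt_mj lt_jl uj ym zl.
by rewrite (edge_part (ltn_trans lt_mj lt_jl) zl ym) (edge_part lt_jl zl uj).
Qed.

(** One neighbourhood contains the other, as is checked for [z] below, above and inside the
    component of [u]; equal degrees turn the inclusion into an equality. *)
Lemma eq_degree_twins (u y : T) j m : m < j -> u \in part j -> y \in part m ->
    #|[set z | e u z]| = #|[set z | e y z]| ->
  forall z, z != u -> z != y -> e u z = e y z.
Proof.
move=> lt_mj uj ym eq_deg.
case: j => // j in lt_mj uj *.
have [_ /ks_partP[E _ cA iB]] := part_pos uj.
have [uA|uA] := boolP (u \in clique_part j.+1).
  (* Here [u] and [y] are adjacent, so closed neighbourhoods are compared. *)
  pose N x := x |: [set z | e x z].
  have cardN x : #|N x| = #|[set z | e x z]|.+1 by rewrite cardsU1 inE e_irr.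
  have sN : N y \subset N u.
    apply/subsetP => z; rewrite !inE => yz.
    have [//|zu] /= := eqVneq z u.
    have [l zl] := part_exists z.
    have [lt_lj|lt_jl|eq_l] := ltngtP l j.+1.
    - by rewrite (edge_part lt_lj uj zl).
    - have zy : z != y.
        apply: contraTneq (ltn_trans lt_mj lt_jl) => zy.
        by rewrite (part_inj zl (_ : z \in part m)) ?zy // ltnn.
      by move: yz; rewrite (negPf zy) e_sym (edge_above lt_mj lt_jl uj ym zl) e_sym.
    have zy : z != y.
      by apply: contraTneq lt_mj => zy; rewrite -eq_l (part_inj zl (_ : z \in part m)) ?zy // ltnn.
    rewrite eq_l in zl; move: yz; rewrite (negPf zy) e_sym (edge_part lt_mj zl ym) => zA.
    by apply: cA; rewrite // eq_sym.
  have /eqP NE : N y == N u by rewrite eqEcard sN !cardN eq_deg leqnn.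
  by move=> z zu zy; move/setP/(_ z): NE; rewrite !inE (negPf zu) (negPf zy).
have uB : u \in (nth (set0, set0) comps j).2.
  by move: uj uA; rewrite E inE => /orP[->|].
have sN : [set z | e u z] \subset [set z | e y z].
  apply/subsetP => z; rewrite !inE => uz.
  have [l zl] := part_exists z.
  have [lt_lj|lt_jl|eq_l] := ltngtP l j.+1.
  - by move: uz; rewrite (edge_part lt_lj uj zl) (negPf uA).
  - by rewrite e_sym (edge_above lt_mj lt_jl uj ym zl) e_sym.
  rewrite eq_l in zl; rewrite e_sym (edge_part lt_mj zl ym).
  move: (zl); rewrite E inE => /orP[//|zB].
  by move: (iB u z uB zB); rewrite uz.
have /eqP NE : [set z | e u z] == [set z | e y z] by rewrite eqEcard sN eq_deg leqnn.
by move=> z _ _; move/setP/(_ z): NE; rewrite !inE.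
Qed.

(** Being a twin of a vertex in another component makes [u] a swing vertex of its component and [y]
    uniform in its own. Each component strictly between lies entirely on one side of its partition,
    hence is again a single vertex. *)
Lemma twins_types (u y : T) j m : m < j -> u \in part j -> y \in part m ->
    (forall z, z != u -> z != y -> e u z = e y z) ->
  forall l, m <= l <= j -> nth None types l = Some (u \in clique_part j).
Proof.
move=> lt_mj uj ym twin; set b := u \in _.
have neq_part (v w : T) i k : v \in part i -> w \in part k -> i != k -> v != w.
  by move=> vi wk; apply: contraNneq => vw; rewrite vw in vi; rewrite (part_inj vi wk).
have part_j : part j = [set u].
  case: j => // j in lt_mj uj b *; have [_ ksj] := part_pos uj.
  apply: (indecomposable_swing e_sym (indecomposable_part uj) ksj uj) => z zj zu.
  rewrite twin // ?(neq_part z y _ _ zj ym) ?gtn_eqF //.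
  by rewrite e_sym (edge_part lt_mj zj ym).
have part_m : part m = [set y].
  apply: (indecomposable_uniform e_irr (b := b) (indecomposable_part ym) ym) => z zm zy.
  have zu : z != u by rewrite (neq_part z u _ _ zm uj) ?ltn_eqF.
  by rewrite -twin // (edge_part lt_mj uj zm).
(* Strictly between, [z] sees [y] according to its side, and [u] sees [z] according to [b]; twinship
   equates the two. *)
have clique_l l z : m < l -> z \in part l -> l <= j -> (z \in clique_part l) = b.
  move=> lt_ml zl; rewrite leq_eqVlt => /orP[/eqP eq_l|lt_lj].
    by move: zl; rewrite eq_l part_j inE => /eqP->.
  have zu : z != u by rewrite (neq_part z u _ _ zl uj) ?ltn_eqF.
  have zy : z != y by rewrite (neq_part z y _ _ zl ym) ?gtn_eqF.
  by rewrite -(edge_part lt_ml zl ym) e_sym -twin // (edge_part lt_lj uj zl).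
have ne_part l : l <= j -> exists z, z \in part l.
  move=> le_lj; have [[/allP ne _ _ _] _] := canonical.
  by apply/set0Pn/ne/mem_nth; apply: leq_ltn_trans (part_bound uj).
have type_l l : m < l <= j -> nth None types l = Some b.
  case/andP=> lt_ml le_lj; have [z zl] := ne_part l le_lj.
  case: l => // l in lt_ml le_lj zl *.
  rewrite (@type_of_singleton _ z) ?clique_l //.
  have [E ks] := part_pos zl; have /ks_partP[_ _ cA iB] := ks.
  apply: (indecomposable_uniform e_irr (b := b) (indecomposable_part zl) zl) => w wl wz.
  have zA := clique_l _ z lt_ml zl le_lj; have wA := clique_l _ w lt_ml wl le_lj.
  move: zA wA; case: (b) => zA wA; first by apply: cA; rewrite // eq_sym.
  by move: zl wl; rewrite E !in_setU zA wA => zB wB; apply/negbTE/iB.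
move=> l /andP[]; rewrite leq_eqVlt => /orP[/eqP<- _|lt_ml le_lj]; last first.
  by rewrite type_l // lt_ml.
(* The lowest type remains. For [m = 0] it is by convention the type of [G_1]; otherwise a vertex
   [w] of [G_0] determines the side of [y], because [y] and [u] see [w] alike. *)
case: m => [|m] in lt_mj ym part_m neq_part clique_l type_l *.
  have := type_l 1 lt_mj; have [z z1] := ne_part 1 lt_mj.
  rewrite (nth_types z1) => t1; rewrite /= /type0.
  have -> : V0 = [set y] by exact: part_m.
  rewrite cards1 eqxx; move: t1; case: (comps) => //=.
  by rewrite /comp_type /= setU0 cards0.
rewrite (type_of_singleton part_m); congr Some.
have [w w0] := ne_part 0 (leq0n j).
have wu : w != u by rewrite (neq_part w u _ _ w0 uj) // ltn_eqF // (leq_ltn_trans _ lt_mj).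
have wy : w != y by rewrite (neq_part w y _ _ w0 ym).
by rewrite -(edge_part (ltn0Sn m) ym w0) -twin // (edge_part _ uj w0) // (leq_ltn_trans _ lt_mj).
Qed.

Lemma eq_degree_run (u y : T) j m : u \in part j -> y \in part m ->
    #|[set z | e u z]| = #|[set z | e y z]| ->
  run_index types j = run_index types m.
Proof.
wlog lt_mj : u y j m / m < j => [wlog_lt uj ym eq_deg|].
  case: (ltngtP j m) => [lt_jm|lt_mj|-> //]; last exact: (wlog_lt u y).
  by rewrite (wlog_lt y u m j).
move=> uj ym /(eq_degree_twins lt_mj uj ym)/(twins_types lt_mj uj ym) tb.
by apply/esym/(run_index_eq (ltnW lt_mj) tb).
Qed.

(** * Compact components: invariance under automorphisms, and gluing *)

Notation cpart := (nth set0 (compact_parts comps V0)).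

Lemma mem_cpart (x : T) k i : x \in part i ->
  (x \in cpart k) = (run_index types i == k).
Proof.
have vE : map (fun x : item T => x.2.1 :|: x.2.2) (items comps V0) = parts comps V0.
  by rewrite /= setU0 -map_comp.
move=> xi; apply/idP/eqP => [/mem_nth_compress[j <-]|rk].
  by rewrite vE => xj; rewrite (part_inj xi xj).
by apply/mem_nth_compress; exists i; rewrite ?vE.
Qed.

Lemma count_compact_parts (x : T) :
  count (fun V : {set T} => x \in V) (compact_parts comps V0) <= 1.
Proof.
have [[_ _ cnt _] _] := canonical.
apply: leq_trans (count_compress (items comps V0) x) _.
by rewrite [map _ _]/= setU0 -map_comp cnt.
Qed.

Lemma cover_compact_parts (x : T) : x \in \bigcup_(V <- compact_parts comps V0) V.
Proof.
have [i xi] := part_exists x; have := mem_cpart (run_index types i) xi.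
rewrite eqxx => xk; rewrite bigcup_seq; apply/bigcupP; exists (cpart (run_index types i)) => //.
by apply: mem_nth; move: xk; case: ltnP => // ?; rewrite nth_default ?inE.
Qed.

Lemma graph_autP (p : {perm T}) :
  reflect (forall x y, e (p x) (p y) = e x y) (p \in graph_aut e).
Proof.
rewrite inE; apply: (iffP forallP) => [pe x y|pe x].
  by have /forallP/(_ y)/eqP := pe x.
by apply/forallP => y; apply/eqP.
Qed.

Lemma graph_aut_degree p (x : T) : p \in graph_aut e ->
  #|[set z | e (p x) z]| = #|[set z | e x z]|.
Proof.
move/graph_autP=> pe; rewrite -(card_imset [set z | e x z] (@perm_inj _ p)).
apply: eq_card => z; apply/idP/imsetP => [|[w + ->]]; rewrite !inE ?pe //.
by move=> epz; exists ((p^-1)%g z); rewrite ?inE ?permKV // -pe permKV.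
Qed.

Lemma graph_aut_compact p V : p \in graph_aut e -> V \in compact_parts comps V0 ->
  forall x, (p x \in V) = (x \in V).
Proof.
move=> pe /(nthP set0)[k _ <-] x.
have [i xi] := part_exists x; have [j pxj] := part_exists (p x).
by rewrite (mem_cpart k xi) (mem_cpart k pxj) (eq_degree_run pxj xi (graph_aut_degree x pe)).
Qed.

(** In a typed run the common type decides the side of every vertex. An untyped component is a run
    by itself, so [p] stabilises it and [indecomposable_aut_ks] applies. Positive positions are
    those carrying a KS-partition. *)
Lemma block_auts_clique_part p x i j : p \in block_auts e (compact_parts comps V0) ->
    0 < i -> 0 < j -> x \in part i -> p x \in part j ->
  (p x \in clique_part j) = (x \in clique_part i).
Proof.
move=> /block_autsP[_ pV ep] i_gt0 j_gt0 xi pxj.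
have run_ij y l : p y \in part l -> forall k, y \in part k ->
    run_index types k = run_index types l.
  move=> pyl k yk; have := mem_cpart (run_index types k) yk; rewrite eqxx.
  set V := cpart _ => yV; have Vcs : V \in compact_parts comps V0.
    by apply: mem_nth; move: yV; rewrite /V; case: ltnP => // ?; rewrite nth_default ?inE.
  by move: yV; rewrite -(pV V Vcs) (mem_cpart _ pyl) => /eqP.
have typed_run k l b : nth None types k = Some b ->
    run_index types k = run_index types l -> nth None types l = Some b.
  move=> tk; case: (ltngtP k l) => [lt_kl|lt_lk|<- //].
    case/(run_index_type lt_kl) => c tc; rewrite -tk !tc //.
      by rewrite leqnn ltnW.
    by rewrite leqnn ltnW.
  move/esym/(run_index_type lt_lk) => [c tc]; rewrite -tk !tc //.
    by rewrite leqnn ltnW.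
  by rewrite leqnn ltnW.
have untyped_run k l : nth None types k = None ->
    run_index types k = run_index types l -> k = l.
  move=> tk; case: (ltngtP k l) => // [lt_kl|lt_lk].
    by case/(run_index_type lt_kl) => c; move/(_ k); rewrite tk leqnn ltnW // => /(_ isT).
  by move/esym/(run_index_type lt_lk) => [c]; move/(_ k); rewrite tk leqnn ltnW // => /(_ isT).
case: i j => [//|i] [//|j] in i_gt0 j_gt0 xi pxj *.
have rij := run_ij x _ pxj _ xi.
case ti: (nth None types i.+1) => [b|].
  by rewrite (type_clique_part xi ti) (type_clique_part pxj (typed_run _ _ _ ti rij)).
have eq_ij := untyped_run _ _ ti rij; rewrite -eq_ij in pxj *.
have [_ ks] := part_pos xi.
apply: (indecomposable_aut_ks e_sym (indecomposable_part xi) ks) => // [y|y z yi zi].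
  have [k yk] := part_exists y; have [l pyl] := part_exists (p y).
  have rkl := run_ij y _ pyl _ yk; apply/idP/idP => [pyi|yi].
    rewrite (part_inj pyl pyi) in rkl.
    by rewrite (untyped_run _ _ ti (esym rkl)).
  rewrite (part_inj yk yi) in rkl.
  by rewrite (untyped_run _ _ ti rkl).
have memV w : w \in part i.+1 -> w \in cpart (run_index types i.+1).
  by move=> wi; rewrite (mem_cpart _ wi).
apply: (ep (cpart (run_index types i.+1))); try exact: memV.
by apply: mem_nth; have := memV y yi; case: ltnP => // ?; rewrite nth_default ?inE.
Qed.

(** Edges inside a compact component are preserved by definition. An edge between two of them
    depends only on the side of its upper end, which [block_auts_clique_part] preserves. *)
Lemma block_auts_compact : block_auts e (compact_parts comps V0) = graph_aut e.
Proof.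
apply/setP => p; apply/idP/idP => [pB|pe]; last first.
  apply/block_autsP; split=> [|V Vcs|V _ x y _ _].
  - by apply/subsetP => x _; apply: cover_compact_parts.
  - exact: graph_aut_compact.
  by move/graph_autP: pe.
have /block_autsP[_ pV ep] := pB.
have compact_run x V : V \in compact_parts comps V0 -> x \in V -> forall i,
    x \in part i -> V = cpart (run_index types i).
  move=> /(nthP set0)[k _ <-] xk i xi.
  by move: xk; rewrite (mem_cpart k xi) => /eqP->.
have edge_lt i j x y : run_index types j < run_index types i ->
    x \in part i -> y \in part j -> e (p x) (p y) = e x y.
  move=> lt_run xi yj.
  have lt_ij k l : run_index types l < run_index types k -> l < k.
    by rewrite !ltnNge; apply: contra; apply: run_index_mono.
  have [i' pxi] := part_exists (p x); have [j' pyj] := part_exists (p y).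
  have run_p z k k' : z \in part k -> p z \in part k' -> run_index types k = run_index types k'.
    move=> zk pzk; have := cover_compact_parts z; rewrite bigcup_seq => /bigcupP[V Vcs zV].
    have VE := compact_run z V Vcs zV k zk.
    by move: zV; rewrite -(pV V Vcs) VE (mem_cpart _ pzk) => /eqP.
  (* Inside a run [p] may permute the components, so the order of [i'] and [j'] is recovered from
     the run indices, which [p] preserves. *)
  have lt_p : j' < i' by apply: lt_ij; rewrite -(run_p x i i') // -(run_p y j j').
  have lt_ji := lt_ij _ _ lt_run.
  rewrite (edge_part lt_p pxi pyj) (edge_part lt_ji xi yj).
  have [i_gt0 i'_gt0] := (leq_ltn_trans (leq0n _) lt_ji, leq_ltn_trans (leq0n _) lt_p).
  exact: (block_auts_clique_part pB).
apply/graph_autP => x y.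
have [i xi] := part_exists x; have [j yj] := part_exists y.
have [lt_run|lt_run|eq_run] := ltngtP (run_index types j) (run_index types i).
- exact: (edge_lt i j).
- by rewrite e_sym (edge_lt j i) // e_sym.
have := cover_compact_parts x; rewrite bigcup_seq => /bigcupP[V Vcs xV].
apply: (ep V) => //; rewrite (compact_run x V Vcs xV i xi) (mem_cpart _ yj).
by rewrite eq_run.
Qed.

End CompactDecomposition.

Theorem mainTheorem6 (T : finType) (e : rel T)
    (e_sym : symmetric e) (e_irr : irreflexive e)
    (comps : seq ({set T} * {set T})) (V0 : {set T}) :
  canonical_decomp e comps V0 ->
  [/\ (forall p, p \in graph_aut e -> forall V, V \in compact_parts comps V0 -> p @: V = V),
      (forall p, p \in graph_aut e -> forall V, V \in compact_parts comps V0 ->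
         exists2 s, s \in aut_on e V & {in V, s =1 p}) &
      (\big[dprod/1]_(V <- compact_parts comps V0) aut_on e V)%g = graph_aut e].
Proof.
move=> can; have autV p V pe Vcs := @graph_aut_compact _ _ e_sym e_irr _ _ can p V pe Vcs.
split=> [p pe V Vcs|p pe V Vcs|].
- apply/eqP; rewrite eqEcard (card_imset _ (@perm_inj _ p)) leqnn andbT.
  by apply/subsetP => _ /imsetP[x xV ->]; rewrite (autV p V).
(* Stability of [V] is what makes [restr_perm V p] agree with [p] on [V]. *)
- have pN : p \in 'N(V | 'P)%g by apply/astabsP => x; apply: (autV p V).
  have pE x : x \in V -> restr_perm V p x = p x by move=> xV; apply: restr_permE.
  exists (restr_perm V p) => //; rewrite inE restr_perm_on.
  apply/forall_inP => x xV; apply/forall_inP => y yV.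
  by rewrite !pE //; apply/eqP/graph_autP.
rewrite block_auts_dprod; first exact: block_auts_compact.
exact: count_compact_parts can.
Qed.
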